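(* Let $K\subseteq\mathbb{R}^n$ be a convex body satisfying $$\max_{y\in e_n^\perp}\mathrm{vol}_1(K\cap(y+\langle e_n\rangle))=\mathrm{vol}_1(K\cap\langle e_n\rangle).$$ Then $$\frac{\binom{2n}{n}}{n^n}\,n\int_0^\infty r^{n-1}G_n(K\cap(re_n+K))\,dr\leq\frac{\binom{2n}{n}}{n^n}\,\rho_{K-K}^n(e_n)\,G_{n-1}(P_{e_n^\perp}(K))+\frac{\big(G_n(S_{e_n}(K)+C_{n-1})+G_{n-1}(P_{e_n^\perp}(K)+C_{n-1})\big)^{n+1}}{\big(G_{n-1}(P_{e_n^\perp}(K))\big)^n}.$$
   Context: A convex body is a compact convex set with non-empty interior. $(e_i)_{i=1}^n$ is the canonical orthonormal basis of $\mathbb{R}^n$, $\langle e_n\rangle$ is the line spanned by $e_n$, $e_n^\perp$ is the linear hyperplane orthogonal to $e_n$ (identified with $\mathbb{R}^{n-1}$), and $P_{e_n^\perp}$ is the orthogonal projection onto $e_n^\perp$. $\mathrm{vol}_1$ is 1-dimensional Lebesgue measure. $G_n(A)=|A\cap\mathbb{Z}^n|$ for $A\subseteq\mathbb{R}^n$, and for $A\subseteq e_n^\perp$, $G_{n-1}(A)=|A\cap\mathbb{Z}^n|$. $C_{n-1}=(-1,1)^{n-1}\times\{0\}\subseteq\mathbb{R}^n$, and $+$ between sets is the Minkowski sum. $S_{e_n}(K)$ is the Steiner symmetrization of $K$ with respect to $e_n^\perp$; for compact $K$, $S_{e_n}(K)=\{(y,t)\in\mathbb{R}^{n-1}\times\mathbb{R}: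 y\in P_{e_n^\perp}(K),\ |t|\leq\tfrac12\mathrm{vol}_1(K\cap(y+\langle e_n\rangle))\}$. $K-K=\{x-y:x,y\in K\}$ is the difference body, and the radial function of a set $L$ star-shaped about $0$ is $\rho_L(\theta)=\sup\{r\geq0: r\theta\in L\}$ for unit vectors $\theta$. *)

(* Defs.v *)
From HB Require Import structures.
From mathcomp Require Import all_boot all_order all_algebra finmap.
From mathcomp Require Import all_classical all_reals all_analysis.

Set Implicit Arguments.
Unset Strict Implicit.
Unset Printing Implicit Defensive.

Import Order.TTheory GRing.Theory Num.Theory.
Import numFieldNormedType.Exports.

Local Open Scope classical_set_scope.
Local Open Scope ring_scope.

(* R^(m+1) is 'rV[R]_m.+1 for an arbitrary R : realType.
   The library norm on row vectors is the sup norm; it only enters below through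
   the topology (compactness, interior), which is the Euclidean one. *)

Definition dotp (R : realType) (n : nat) (x y : 'rV[R]_n) : R :=
  \sum_(i < n) x 0 i * y 0 i.

(* e_n in R^n, with n = m + 1. *)
Definition last_vec (R : realType) (m : nat) : 'rV[R]_m.+1 :=
  delta_mx 0 ord_max.

Definition convex_body (R : realType) (m : nat) (K : set 'rV[R]_m.+1) : Prop :=
  [/\ compact K, convex_set K & K° !=set0].

(* The set u^\perp, kept inside R^n. *)
Definition orth (R : realType) (n : nat) (u : 'rV[R]_n) : set 'rV[R]_n :=
  [set x | dotp x u = 0].

(* The orthogonal projection onto u^\perp when u is a unit vector. *)
Definition orth_proj (R : realType) (n : nat) (u x : 'rV[R]_n) : 'rV[R]_n :=
  x - dotp x u *: u.

(* vol_1(K \cap (y + <u>)) for a unit vector u: t |-> y + t u is then an isometry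
   from the real line onto the line y + <u>. *)
Definition section_vol1 (R : realType) (n : nat) (u : 'rV[R]_n)
    (K : set 'rV[R]_n) (y : 'rV[R]_n) : \bar R :=
  lebesgue_measure [set t : R | K (y + t *: u)].

Definition steiner (R : realType) (n : nat) (u : 'rV[R]_n)
    (K : set 'rV[R]_n) : set 'rV[R]_n :=
  [set x | exists (y : 'rV[R]_n) (t : R),
     [/\ (orth_proj u @` K) y,
         (`|t|%:E <= (2^-1)%:E * section_vol1 u K y)%E
       & x = y + t *: u]].

Definition minkowski_sum (R : realType) (n : nat)
    (A B : set 'rV[R]_n) : set 'rV[R]_n :=
  [set x + y | x in A & y in B].

Definition difference_body (R : realType) (n : nat)
    (K : set 'rV[R]_n) : set 'rV[R]_n :=
  [set x - y | x in K & y in K].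

Definition translate (R : realType) (n : nat) (v : 'rV[R]_n)
    (K : set 'rV[R]_n) : set 'rV[R]_n :=
  [set v + x | x in K].

Definition radial (R : realType) (n : nat) (L : set 'rV[R]_n)
    (theta : 'rV[R]_n) : R :=
  sup [set r : R | 0 <= r /\ L (r *: theta)].

(* C_{n-1} = (-1,1)^{n-1} x {0}, with n = m + 1. *)
Definition flat_cube (R : realType) (m : nat) : set 'rV[R]_m.+1 :=
  [set x | x 0 ord_max = 0 /\ forall i, i != ord_max -> -1 < x 0 i < 1].

Definition int_lattice (R : realType) (n : nat) : set 'rV[R]_n :=
  [set x | forall i, x 0 i \is a Num.int].

(* The number of integer points of a bounded set A (fset_set is empty on infinite
   sets, so the value is meaningless when A contains infinitely many of them).
   For A inside e_n^\perp this is also G_{n-1}(A), since e_n^\perp is kept as a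
   subset of R^n. *)
Definition lattice_count (R : realType) (n : nat) (A : set 'rV[R]_n) : nat :=
  #|` fset_set (A `&` @int_lattice R n)|%fset.

(* Main.v *)
Require Import Defs.
From HB Require Import structures.
From mathcomp Require Import all_boot all_order all_algebra finmap.
From mathcomp Require Import all_classical all_reals all_analysis.
From mathcomp Require Import measurable_realfun ring lra zify.

(** Write n = m + 1, e for the last basis vector, P for the projection of K
    along e, f(y) for the length of the section of K over y in P, N for the
    number of lattice points of P, C for the flat cube, S for the Steiner
    symmetral of K, and W for the sum of the numbers of lattice points of S + C
    and of P + C.

    The integrand on the left counts the lattice points z of K with r at most
    the height of z above the lower end of its section, so the layer-cake
    formula turns n times the integral into the sum of the n-th powers of these
    heights (integral_lattice_covariogram).  In a section of length l the
    heights have consecutive differences at least 1, hence their n-th powers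
    sum to at most l^n + l^(n+1) / (n + 1) (sum_pow_spread).  It remains to sum
    over the lattice points y of P.  The terms f(y)^n are bounded by the n-th
    power of the radial function of K - K, which gives the first term on the
    right.

    The sum of the f(y)^(n+1) / (n + 1) is controlled by a discrete form of
    Berwald's inequality.  Give every lattice point z of P + C the weight 1 plus
    the number of lattice points of S + C above z.  These weights add up to W,
    and the weight of z is at least f(y) for every y of P with z - y in C,
    because [-f/2, f/2] contains at least f - 1 integers
    (fiber_weight_cover).  Let a(s) be the number of lattice points y of P with
    f(y) >= s, and b(s) the number of z whose weight is at least s.  Concavity
    of f and the discrete Brunn-Minkowski inequality show that b^(1/m) at
    (1 - t) 0 + t s is at least the corresponding mean of a(0)^(1/m) = N^(1/m)
    and a(s)^(1/m).  Compare both counts with N (1 - s/M)^m, where M = n W / N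
    is chosen to make its integral equal to W.  By the interpolation property
    there is a threshold T such that b is at least this profile before T and a
    at most this profile after T (crossing); integrating against s^n - T^n
    bounds the (n+1)-st moment of a by that of the profile, which is a beta
    integral (discrete_berwald).  The beta integral produces exactly the
    constant of the theorem (berwald_constant).

    The discrete Brunn-Minkowski inequality is proved by induction on the number
    of free coordinates: slice by the last free coordinate, normalize the slice
    counts of A and of B by their maxima, apply the one-dimensional inequality
    to the sets of slices whose normalized count exceeds a level s, integrate
    over s, and finish with a convexity inequality (perspective_pow). *)

Set Implicit Arguments.
Unset Strict Implicit.
Unset Printing Implicit Defensive.

Import Order.TTheory GRing.Theory Num.Theory.
Import numFieldNormedType.Exports.

Local Open Scope classical_set_scope.
Local Open Scope ring_scope.

(** * Integrals of step functions and truncated monomials *)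

(** Integrability is bundled with the value, so that identities between
    integrals can be assembled from their terms without separate measurability
    or integrability side conditions. *)
Definition has_integral (R : realType) (f : R -> R) (v : R) : Prop :=
  (@lebesgue_measure R).-integrable [set: R] (EFin \o f) /\
  (\int[@lebesgue_measure R]_(x in [set: R]) f x = v).

Lemma has_integral_eq (R : realType) (f g : R -> R) (v : R) :
  f =1 g -> has_integral f v -> has_integral g v.
Proof. by move=> /funext ->. Qed.

Lemma has_integralD (R : realType) (f g : R -> R) (v w : R) :
  has_integral f v -> has_integral g w ->
  has_integral (fun x => f x + g x) (v + w).
Proof.
move=> [fi <-] [gi <-]; split; last by rewrite RintegralD.
rewrite (_ : EFin \o _ = ((EFin \o f) \+ (EFin \o g))%E)//.
exact: integrableD.
Qed.

Lemma has_integralZ (R : realType) (f : R -> R) (v k : R) :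
  has_integral f v -> has_integral (fun x => k * f x) (k * v).
Proof.
move=> [fi <-]; split; last by rewrite RintegralZl.
rewrite (_ : EFin \o _ = (fun x => k%:E * (EFin \o f) x)%E)//.
exact: integrableZl.
Qed.

Lemma has_integral_sum (R : realType) (I : eqType) (r : seq I) (f : I -> R -> R)
    (v : I -> R) :
  {in r, forall i, has_integral (f i) (v i)} ->
  has_integral (fun x => \sum_(i <- r) f i x) (\sum_(i <- r) v i).
Proof.
elim: r => [_|i r IH h].
  rewrite big_nil; apply: (@has_integral_eq _ (cst 0)).
    by move=> x; rewrite big_nil.
  split; last by rewrite /Rintegral integral0.
  exact: integrable0.
rewrite big_cons.
apply: (@has_integral_eq _ (fun x => f i x + \sum_(j <- r) f j x)).
  by move=> x; rewrite big_cons.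
apply: has_integralD; first by apply: h; rewrite mem_head.
by apply: IH => j jr; apply: h; rewrite inE jr orbT.
Qed.

Lemma has_integral_le (R : realType) (f g : R -> R) (v w : R) :
  has_integral f v -> has_integral g w -> (forall x, f x <= g x) -> v <= w.
Proof. by move=> [fi <-] [gi <-] fg; apply: le_Rintegral. Qed.

Lemma has_integral_itv (R : realType) (l u : R) : l <= u ->
  has_integral (fun x => (l <= x < u)%R%:R) (u - l).
Proof.
move=> lu; apply: (@has_integral_eq _ \1_(`[l, u[%classic)).
  by move=> x; rewrite indicE mem_setE in_itv.
split; first exact: integrable_indic_itv.
rewrite /Rintegral integral_indic// setIT [X in fine X]lebesgue_measure_itv/=.
rewrite lte_fin; case: ltP => // ul.
by rewrite (@le_anti _ _ l u) ?subrr// lu ul.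
Qed.

Lemma has_integral_beta (R : realType) (a b : nat) :
  has_integral (fun x : R => x ^+ a * (1 - x) ^+ b * (0 <= x <= 1)%R%:R)
    ((a`! * b`!)%:R / (a + b).+1`!%:R).
Proof.
apply: (@has_integral_eq _ (@XMonemX R a b \_ `[0, 1])).
  move=> x; rewrite patchE mem_setE in_itv/=.
  by case: ifP => _; rewrite ?mulr1 ?mulr0.
split; last by rewrite -beta_fun_fact.
exact: (integrable_XMonemX_restrict a.+1 b.+1).
Qed.

Lemma has_integral_monomial (R : realType) (k : nat) (t : R) : 0 <= t ->
  has_integral (fun x : R => x ^+ k * (0 <= x <= t)%R%:R) (t ^+ k.+1 / k.+1%:R).
Proof.
move=> t0; apply: (@has_integral_eq _ ((fun x => x ^+ k) \_ `[0, t])).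
  move=> x; rewrite patchE mem_setE in_itv/=.
  by case: ifP => _; rewrite ?mulr1 ?mulr0.
have cX (s : nat) : {within `[0, t], continuous (fun x : R => x ^+ s)}.
  by apply: continuous_subspaceT => x; exact: exprn_continuous.
split.
  rewrite -restrict_EFin; apply/integrable_restrict => //=.
  rewrite setTI; apply: continuous_compact_integrable => //.
  exact: segment_compact.
rewrite -Rintegral_mkcond.
move: t0; rewrite le_eqVlt => /predU1P[<-|t0].
  by rewrite set_itv1 Rintegral_set1 expr0n mul0r.
rewrite /Rintegral (@continuous_FTC2 _ _ (fun x => x ^+ k.+1 / k.+1%:R))//=.
- by rewrite expr0n mul0r subr0.
- split.
  + by move=> x _; apply: derivableM => //; exact: exprn_derivable.
  + apply: cvg_at_right_filter; apply: cvgM; last exact: cvg_cst.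
    exact: exprn_continuous.
  + apply: cvg_at_left_filter; apply: cvgM; last exact: cvg_cst.
    exact: exprn_continuous.
- move=> x _; rewrite derive1Mr; last exact: exprn_derivable.
  by rewrite derive1E exp_derive scaler1 mulrAC divff// mul1r.
Qed.

(** An inequality between step functions, integrated.  It is used with all
    weights 1 to compare lengths of unions of disjoint intervals, and with
    intervals starting at 0 as a layer-cake formula. *)
Lemma le_sum_itv (R : realType) (I J : eqType) (r : seq I) (s : seq J)
    (w l u : I -> R) (w' l' u' : J -> R) :
  (forall i, l i <= u i) -> (forall j, l' j <= u' j) ->
  (forall x : R, \sum_(i <- r) w i * (l i <= x < u i)%R%:R <=
             \sum_(j <- s) w' j * (l' j <= x < u' j)%R%:R) ->
  \sum_(i <- r) w i * (u i - l i) <= \sum_(j <- s) w' j * (u' j - l' j).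
Proof.
move=> lu lu'; apply: has_integral_le;
  by apply: has_integral_sum => i _; apply/has_integralZ/has_integral_itv.
Qed.

(** * Elementary inequalities and finite sums *)

Lemma seq_argmax (R : realType) (T : eqType) (s : seq T) (f : T -> R) (x0 : T) :
  x0 \in s -> exists2 x, x \in s & {in s, forall y, f y <= f x}.
Proof.
elim: s x0 => // a s IH x0 _.
case: s IH => [_|b s IH].
  by exists a; rewrite ?mem_head// => y; rewrite inE => /eqP->.
have [x xs hx] := IH b (mem_head _ _).
have [fax|/ltW fxa] := leP (f a) (f x).
  exists x; first by rewrite inE xs orbT.
  by move=> y; rewrite inE => /orP[/eqP->//|]; exact: hx.
exists a; first exact: mem_head.
by move=> y; rewrite inE => /orP[/eqP->//|/hx /le_trans]; exact.
Qed.

(** Bernoulli's inequality in homogeneous form: the graph of z |-> z^(k+1) lies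
    above its tangent at c. *)
Lemma pow_tangent (R : realType) (k : nat) (c z : R) : 0 <= c -> 0 <= z ->
  k.+1%:R * c ^+ k * z - k%:R * c ^+ k.+1 <= z ^+ k.+1.
Proof.
move=> c0 z0; elim: k => [|k IH].
  by rewrite expr0 mul1r mul1r mul0r subr0 expr1.
rewrite [leRHS]exprS; apply: le_trans (ler_wpM2l z0 IH).
have ck := exprn_ge0 k c0; rewrite -subr_ge0 !exprS -!natr1.
set d := c ^+ k in ck *.
rewrite [X in 0 <= X](_ : _ = (k%:R + 1) * d * (z - c) ^+ 2); last by ring.
by rewrite mulr_ge0 ?sqr_ge0// mulr_ge0// addr_ge0.
Qed.

(** Joint convexity of (x, u) |-> x^(k+1) / u^k.  The tangent line inequality
    at the common slope c, the ratio of the two weighted means, is linear in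
    (x, u), so it can be averaged; at this c it becomes sharp. *)
Lemma perspective_pow (R : realType) (k : nat) (al be x y u v : R) :
  0 <= al -> 0 <= be -> 0 <= x -> 0 <= y -> 0 < u -> 0 < v ->
  0 < al * u + be * v ->
  (al * x + be * y) ^+ k.+1 <=
  (al * u + be * v) ^+ k *
    (al * (x ^+ k.+1 / u ^+ k) + be * (y ^+ k.+1 / v ^+ k)).
Proof.
move=> al0 be0 x0 y0 u0 v0 s0.
set S := al * u + be * v in s0 *; set X := al * x + be * y.
have X0 : 0 <= X by rewrite addr_ge0 ?mulr_ge0.
pose c := X / S.
have c0 : 0 <= c by rewrite divr_ge0 // ltW.
have tangent t w : 0 <= t -> 0 < w ->
    k.+1%:R * c ^+ k * t - k%:R * c ^+ k.+1 * w <= t ^+ k.+1 / w ^+ k.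
  move=> t0 w0.
  have := pow_tangent k c0 (divr_ge0 t0 (ltW w0)).
  move=> /(ler_wpM2r (ltW w0)).
  rewrite mulrBl mulrA divfK ?gt_eqF//; congr (_ <= _).
  by rewrite expr_div_n [w ^+ k.+1]exprSr invfM mulrA divfK ?gt_eqF.
apply: (@le_trans _ _ (S ^+ k * (c ^+ k.+1 * S))).
  have Sk : S ^+ k != 0 by rewrite expf_neq0// gt_eqF.
  rewrite /c expr_div_n [S ^+ k.+1]exprS le_eqVlt; apply/orP; left; apply/eqP.
  by field; rewrite Sk gt_eqF.
apply: ler_wpM2l; first by rewrite exprn_ge0// ltW.
have := lerD (ler_wpM2l al0 (tangent _ _ x0 u0)) (ler_wpM2l be0 (tangent _ _ y0 v0)).
apply: le_trans.
have cSX : c * S = X by rewrite /c divfK// gt_eqF.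
rewrite le_eqVlt; apply/orP; left; apply/eqP.
rewrite [RHS](_ : _ = k.+1%:R * c ^+ k * X - k%:R * c ^+ k.+1 * S).
  by rewrite -cSX !exprS -natr1; ring.
by rewrite /X /S; ring.
Qed.

(** The case k = 0 occurs at the first step of the induction on dimension,
    where all slices are points and P = 1. *)
Lemma root_exists (R : realType) (k : nat) (P : R) : 0 < P ->
  (k = 0%N -> P = 1) -> exists2 u : R, 0 < u & u ^+ k = P.
Proof.
move=> P0; case: k => [->//|k _]; first by exists 1; rewrite ?expr0.
exists (P `^ (k.+1%:R^-1)); first exact: powR_gt0.
by rewrite -powR_mulrn ?powR_ge0// -powRrM mulVf// powRr1// ltW.
Qed.

Lemma sum_indicator_le_witness (R : realType) (T U : eqType) (r : seq T) (s : seq U)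
    (P : pred T) (Q : pred U) :
  uniq r -> {in r &, forall t t', P t -> P t' -> t = t'} ->
  {in r, forall t, P t -> exists2 l, l \in s & Q l} ->
  \sum_(t <- r) (P t)%:R <= \sum_(l <- s) (Q l)%:R :> R.
Proof.
move=> ur Pinj PQ; have [/hasP[t tr Pt]|/hasPn nP] := boolP (has P r); last first.
  rewrite big1_seq ?sumr_ge0// => t /andP[_ tr].
  by rewrite (negbTE (nP t tr)).
rewrite (big_rem t)//= Pt big1_seq ?addr0; last first.
  move=> t' /andP[_]; rewrite (mem_rem_uniq _ ur) inE => /andP[t't t'r].
  case: (boolP (P t')) => // /(Pinj _ _ t'r tr)/(_ Pt)/eqP.
  by rewrite (negbTE t't).
have [l ls Ql] := PQ _ tr Pt.
by rewrite (big_rem l)//= Ql lerDl sumr_ge0.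
Qed.

Lemma sumr_const_seq (V : nmodType) (T : Type) (r : seq T) (x : V) :
  \sum_(i <- r) x = x *+ size r.
Proof. by rewrite big_const_seq iter_addr addr0 count_predT. Qed.

Lemma leq_ord_max (n : nat) (i : 'I_n.+1) : (n <= i)%N = (i == ord_max).
Proof. by rewrite -val_eqE /= eqn_leq -[(i <= n)%N]ltnS ltn_ord. Qed.

Lemma sum_indicator_card (V : nzSemiRingType) (T : choiceType) (A : {fset T})
    (P : pred T) :
  \sum_(a <- A) (P a)%:R = (#|` [fset a in A | P a]%fset|)%:R :> V.
Proof.
rewrite card_fset_sum1 natr_sum -big_fset_condE [RHS]big_mkcond /=.
by apply: eq_bigr => a _; case: (P a).
Qed.

Lemma sum_card_fiber (T U : choiceType) (h : T -> U) (A : {fset T}) :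
  (\sum_(i <- (h @` A)%fset) #|` [fset a in A | h a == i]%fset| = #|` A|)%N.
Proof.
rewrite [RHS]card_fset_sum1 (partition_big_imfset _ h).
by apply: eq_bigr => i _; rewrite card_fset_sum1 [RHS]big_fset_condE.
Qed.

Lemma sum_fiber (V : nmodType) (T U : choiceType) (h : T -> U) (A : {fset T})
    (B : {fset U}) (F : T -> V) : {in A, forall z, h z \in B} ->
  \sum_(z <- A) F z = \sum_(y <- B) \sum_(z <- A | h z == y) F z.
Proof.
move=> AB; rewrite (partition_big_imfset _ h); apply: big_fset_incl.
  by apply/fsubsetP => _ /imfsetP[/= z zA ->]; exact: AB.
move=> y yB yA; rewrite big_seq_cond big_pred0// => z.
apply: contraNF yA => /andP[zA /eqP <-]; exact: in_imfset.
Qed.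

(** Sum versus integral for an increasing function: removing the largest k,
    the other terms are at distance at least 1 below it, and
    x^(p+2) - (x-1)^(p+2) >= (p+2) (x-1)^(p+1) makes the bound telescope. *)
Lemma sum_pow_spread (R : realType) (p : nat) (S : {fset int}) (lo M : R) :
  0 <= M -> {in S, forall k : int, lo <= k%:~R <= lo + M} ->
  \sum_(k <- S) (k%:~R - lo) ^+ p.+1 <= M ^+ p.+1 + M ^+ p.+2 / p.+2%:R.
Proof.
have [n] := ubnP (#|` S|)%N; elim: n S M => // n IH S M /ltnSE cardS M0 SM.
have pM : 0 <= M ^+ p.+1 + M ^+ p.+2 / p.+2%:R.
  by rewrite addr_ge0 ?divr_ge0 ?exprn_ge0.
have [->|/fset0Pn[k0 k0S]] := eqVneq S fset0; first by rewrite big_seq_fset0.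
have [k kS kmax] := seq_argmax (fun k : int => k%:~R : R) k0S.
rewrite (big_fsetD1 k)//=.
have /andP[k1 k2] := SM _ kS.
set x := k%:~R - lo; have x0 : 0 <= x by rewrite subr_ge0.
have xM : x <= M by rewrite lerBlDl.
apply: (@le_trans _ _ (x ^+ p.+1 + x ^+ p.+2 / p.+2%:R)); last first.
  by rewrite lerD ?ler_wpM2r ?lerXn2r ?nnegrE.
rewrite lerD2l.
have [S0|/fset0Pn[k' k'S]] := eqVneq (S `\ k)%fset fset0.
  by rewrite S0 big_seq_fset0 divr_ge0 ?exprn_ge0.
have below (j : int) : j \in (S `\ k)%fset -> lo <= j%:~R <= lo + (x - 1).
  rewrite !inE => /andP[jk jS]; have /andP[-> _] /= := SM _ jS.
  have := kmax _ jS; rewrite ler_int le_eqVlt (negbTE jk)/= => jltk.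
  have : j%:~R + 1 <= k%:~R :> R by rewrite -[1]/(1%:~R) -intrD ler_int lezD1.
  by rewrite /x; lra.
have x1 : 0 <= x - 1 by have /andP[] := below _ k'S; lra.
apply: le_trans (IH _ _ _ x1 below) _.
  by rewrite (cardfsD1 k) kS in cardS.
rewrite ler_pdivlMr// mulrDl divfK ?pnatr_eq0//.
apply: le_trans (pow_tangent p.+1 x1 x0).
rewrite le_eqVlt; apply/orP; left; apply/eqP.
by rewrite -[p.+2%:R]natr1 ![(x - 1) ^+ _.+1]exprS; ring.
Qed.

(** * The discrete Brunn-Minkowski inequality *)

(** The one-dimensional case.  The set al I + be J + [0, 1) is contained in
    L + [0, 1), since the integer part of each of its points lies in L.  It
    contains the intervals of length al starting at al i + be jm, with jm the
    minimum of J, and the intervals of length be starting at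
    al im + be j + al, with im the maximum of I.  All these intervals are
    disjoint, so their total length is at most the number of elements of L. *)
Lemma brunn_minkowski_int (R : realType) (al be : R) (I J L : {fset int}) :
  0 <= al -> 0 <= be -> al + be = 1 -> I != fset0 -> J != fset0 ->
  (forall i j l, i \in I -> j \in J ->
     `|l%:~R - al * i%:~R - be * j%:~R| < 1 -> l \in L) ->
  al * (#|` I|)%:R + be * (#|` J|)%:R <= (#|` L|)%:R.
Proof.
move=> al0 be0 ab1 /fset0Pn[i0 i0I] /fset0Pn[j0 j0J] hL.
have [im imI him] := seq_argmax (fun i : int => i%:~R : R) i0I.
(* The maximum of the opposites is reached at the minimum of J. *)
have [jm jmJ hjm] := seq_argmax (fun i : int => - i%:~R : R) j0J.
pose lo (t : int + int) : R := match t with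
  | inl i => al * i%:~R + be * jm%:~R
  | inr j => al * im%:~R + be * j%:~R + al end.
pose wd (t : int + int) : R := if t is inl _ then al else be.
pose r : seq (int + int) :=
  map inl (enum_fset I) ++ map inr (enum_fset J).
have wd0 t : 0 <= wd t by case: t.
have inl_inj : injective (@inl int int) by move=> ? ? [].
have inr_inj : injective (@inr int int) by move=> ? ? [].
have inl_r i : (inl i \in r) = (i \in I).
  rewrite mem_cat mem_map//; case: (i \in I) => //=.
  by apply/negbTE/mapP => -[].
have inr_r j : (inr j \in r) = (j \in J).
  rewrite mem_cat orbC mem_map//; case: (j \in J) => //=.
  by apply/negbTE/mapP => -[].
have key : \sum_(t <- r) 1 * (lo t + wd t - lo t) <=
    \sum_(l <- L) 1 * (l%:~R + 1 - l%:~R) :> R.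
  apply: le_sum_itv => // [t|l|x]; rewrite ?lerDl//.
  have shift (v : R) : v <= x < v + 1 ->
      exists2 l : int, l%:~R <= x < l%:~R + 1 & `|l%:~R - v| < 1.
    move=> /andP[vx xv]; exists (Num.floor x).
      by rewrite floor_le/= -[1 in ltRHS]/(1%:~R) -intrD floorD1_gt ?num_real.
    have := floor_le x; have := floorD1_gt x; rewrite intrD => h1 h2.
    by rewrite ltr_norml; apply/andP; split; lra.
  under eq_bigr do rewrite mul1r; under [leRHS]eq_bigr do rewrite mul1r.
  apply: sum_indicator_le_witness.
  - rewrite cat_uniq !map_inj_uniq ?fset_uniq//=.
    rewrite andbT; apply/hasPn => _ /mapP[j _ ->]; apply/mapP => -[] //.
  - have mono (c : R) (i i' : int) : 0 <= c ->
        c * i%:~R < c * (i'%:~R + 1) -> (i <= i')%R.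
      move=> c0; apply: contraTT; rewrite -leNgt -ltNge => ii'.
      by rewrite ler_wpM2l// -[1]/(1%:~R) -intrD ler_int lezD1.
    have uniq_int (c d : R) (i i' : int) : 0 <= c ->
        c * i%:~R + d <= x < c * i%:~R + d + c ->
        c * i'%:~R + d <= x < c * i'%:~R + d + c -> i = i'.
      move=> c0 /andP[a1 a2] /andP[b1 b2].
      by apply/eqP; rewrite eq_le !(mono c)//; lra.
    have sep i j : i \in I -> j \in J ->
        al * i%:~R + be * jm%:~R <= x < al * i%:~R + be * jm%:~R + al ->
        al * im%:~R + be * j%:~R + al <= x < al * im%:~R + be * j%:~R + al + be ->
        False.
      move=> iI jJ /andP[_ a2] /andP[b1 _].
      have := ler_wpM2l al0 (him _ iI); have := ler_wpM2l be0 (hjm _ jJ).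
      by lra.
    case=> [i|j] [i'|j']; rewrite ?inl_r ?inr_r.
    + by move=> _ _ h1 h2; congr inl; apply: (@uniq_int al (be * jm%:~R)).
    + by move=> iI jJ h1 h2; case: (sep _ _ iI jJ h1 h2).
    + by move=> jJ iI h1 h2; case: (sep _ _ iI jJ h2 h1).
    + move=> _ _ h1 h2; congr inr.
      apply: (@uniq_int be (al * im%:~R + al)) => //.
        by move: h1; rewrite /lo/=; lra.
      by move: h2; rewrite /lo/=; lra.
  - case=> i; rewrite ?inl_r ?inr_r => iI /= /andP[h1 h2].
      have [l xl lv] : exists2 l : int, l%:~R <= x < l%:~R + 1 &
          `|l%:~R - (al * i%:~R + be * jm%:~R)| < 1.
        by apply: shift; lra.
      by exists l => //; apply: (hL i jm) => //; rewrite -addrA -opprD.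
    have [l xl lv] : exists2 l : int, l%:~R <= x < l%:~R + 1 &
        `|l%:~R - (al * im%:~R + be * i%:~R)| < 1.
      by apply: shift; lra.
    by exists l => //; apply: (hL im i) => //; rewrite -addrA -opprD.
move: key; rewrite big_cat !big_map /=.
have E (c : R) (v : int -> R) (A : {fset int}) :
    \sum_(i <- A) 1 * (v i + c - v i) = c * (#|` A|)%:R.
  rewrite (eq_bigr (fun=> c)); last by move=> i _; ring.
  by rewrite big_const_seq iter_addr addr0 count_predT mulr_natr.
by rewrite !E mul1r.
Qed.

(** The points of D lie in a common translate of the span of the first k
    coordinate vectors.  Keeping all dimensions inside one ambient lattice
    makes slicing a matter of restricting a set. *)
Definition agree_from (n k : nat) (D : {fset 'rV[int]_n}) : Prop :=
  {in D &, forall (a a' : 'rV[int]_n), forall i : 'I_n,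
     (k <= i)%N -> a 0 i = a' 0 i}.

(** The set Z contains the lattice points of al A + be B + (-1, 1)^k in the
    slice of the ambient lattice determined by zeta.  In terms of k-th roots,
    the conclusion is that the root of the cardinal of Z is at least the mean of
    those of A and B; the common factor w avoids roots and makes the statement
    homogeneous.

    For the induction step let u^k and v^k be the largest sizes of a layer of A
    and of B.  Layers of relative size larger than s in A and in B produce, by
    the induction hypothesis, layers of Z of size larger than
    s (al u + be v)^k, and the one-dimensional inequality counts them;
    integrating over s in [0, 1) bounds the size of Z from below by
    (al u + be v)^k (al |A| / u^k + be |B| / v^k), to which the joint convexity
    of perspective_pow applies. *)
Lemma discrete_brunn_minkowski (R : realType) (n : nat) (al be : R) :
  0 <= al -> 0 <= be -> al + be = 1 ->
  forall (k : nat) (A B Z : {fset 'rV[int]_n}) (zeta : 'rV[int]_n) (w x y : R),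
  (k <= n)%N -> A != fset0 -> B != fset0 -> 0 <= w -> 0 <= x -> 0 <= y ->
  agree_from k A -> agree_from k B ->
  (forall (a b z : 'rV[int]_n), a \in A -> b \in B ->
     (forall i : 'I_n, (i < k)%N ->
        `|(z 0 i)%:~R - al * (a 0 i)%:~R - be * (b 0 i)%:~R| < 1) ->
     (forall i : 'I_n, (k <= i)%N -> z 0 i = zeta 0 i) -> z \in Z) ->
  w * x ^+ k <= (#|` A|)%:R -> w * y ^+ k <= (#|` B|)%:R ->
  w * (al * x + be * y) ^+ k <= (#|` Z|)%:R.
Proof.
move=> al0 be0 ab1; elim=> [|k IH] A B Z zeta w x y kn.
  move=> /fset0Pn[a aA] /fset0Pn[b bB] w0 _ _ hA hB hZ.
  have card1 (D : {fset 'rV[int]_n}) :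
      agree_from 0 D -> (#|` D| <= 1)%N.
    move=> hD; have [->|/fset0Pn[d dD]] := eqVneq D fset0.
      by rewrite cardfs0.
    suff /fsubset_leq_card : (D `<=` [fset d])%fset by rewrite cardfs1.
    apply/fsubsetP => d' d'D.
    by rewrite inE; apply/eqP/rowP => i; exact: hD.
  rewrite !expr0 mulr1 => wA _; apply: le_trans wA _; rewrite ler_nat.
  apply: leq_trans (card1 _ hA) _; rewrite cardfs_gt0; apply/fset0Pn.
  by exists zeta; exact: (hZ a b).
move=> A0 B0 w0 x0 y0 hA hB hZ wA wB.
pose kk : 'I_n := Ordinal kn.
pose h (a : 'rV[int]_n) : int := a 0 kk.
pose layer (D : {fset 'rV[int]_n}) i := [fset a in D | h a == i]%fset.
have agree D i : agree_from k.+1 D -> agree_from k (layer D i).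
  move=> hD a a'; rewrite !inE => /andP[aD /eqP ai] /andP[a'D /eqP a'i] j.
  rewrite leq_eqVlt => /orP[/eqP kj|]; last exact: hD.
  by have -> : j = kk by [apply/val_inj]; rewrite -[LHS]/(h a) ai -a'i.
have h_layer D i a : a \in layer D i -> i \in (h @` D)%fset.
  by rewrite !inE => /andP[aD /eqP <-]; exact: in_imfset.
(* A largest layer, together with the k-th root of its size. *)
have top D : D != fset0 -> agree_from k.+1 D ->
    exists i u, [/\ 0 < u, layer D i != fset0, (#|` layer D i|)%:R = u ^+ k &
      forall j, (#|` layer D j|)%:R <= u ^+ k :> R].
  move=> /fset0Pn[d dD] hD.
  have [i ihD himax] := seq_argmax (fun i => (#|` layer D i|)%:R : R)
    (in_imfset imfset_key h dD).
  have i0 : layer D i != fset0.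
    move: ihD => /imfsetP[/= a aD ->]; apply/fset0Pn; exists a.
    by rewrite !inE aD eqxx.
  have P0 : 0 < (#|` layer D i|)%:R :> R by rewrite ltr0n cardfs_gt0.
  have [k0|u u0 uk] := root_exists (k := k) P0.
    have [a aD] := fset0Pn _ i0.
    rewrite (_ : layer D i = [fset a]%fset) ?cardfs1//; apply/fsetP => b.
    rewrite inE; apply/idP/eqP => [bD|->//]; apply/rowP => j.
    by apply: (agree D i) => //; rewrite k0.
  exists i, u; split => // j; rewrite uk.
  have [jhD|jhD] := boolP (j \in (h @` D)%fset); first exact: himax.
  suff -> : layer D j = fset0 by rewrite cardfs0.
  by apply/fsetP => b; rewrite in_fset0; apply: contraNF jhD; exact: h_layer.
have [iA [u [u0 iA0 uA uP]]] := top A A0 hA.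
have [jB [v [v0 jB0 vB vQ]]] := top B B0 hB.
have s0 : 0 < al * u + be * v.
  have [al_gt0|al_le0] := ltP 0 al.
    by rewrite ltr_pwDl ?(mulr_gt0 al_gt0 u0)// mulr_ge0// ltW.
  have be_gt0 : 0 < be by lra.
  by rewrite ltr_wpDl ?(mulr_gt0 be_gt0 v0)// mulr_ge0// ltW.
set R0 := (al * u + be * v) ^+ k.
have R0_gt0 : 0 < R0 by exact: exprn_gt0.
have uk0 : 0 < u ^+ k by exact: exprn_gt0.
have vk0 : 0 < v ^+ k by exact: exprn_gt0.
pose p i : R := (#|` layer A i|)%:R / u ^+ k.
pose q j : R := (#|` layer B j|)%:R / v ^+ k.
pose r l : R := (#|` layer Z l|)%:R / R0.
have p0 i : 0 <= p i by rewrite divr_ge0// ltW.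
have q0 i : 0 <= q i by rewrite divr_ge0// ltW.
have r0 i : 0 <= r i by rewrite divr_ge0// ltW.
have step i j l : 0 < p i -> 0 < q j ->
    `|l%:~R - al * i%:~R - be * j%:~R| < 1 -> Order.min (p i) (q j) <= r l.
  move=> pi0 qj0 lij; rewrite /r ler_pdivlMr//.
  pose zeta' : 'rV[int]_n := \row_j0 if j0 == kk then l else zeta 0 j0.
  apply: (IH (layer A i) (layer B j) _ zeta').
  - exact: ltnW.
  - by apply: contraTneq pi0 => e; rewrite /p e cardfs0 mul0r ltxx.
  - by apply: contraTneq qj0 => e; rewrite /q e cardfs0 mul0r ltxx.
  - by rewrite le_min p0 q0.
  - exact: ltW.
  - exact: ltW.
  - exact: agree.
  - exact: agree.
  - move=> a b z; rewrite !inE => /andP[aA /eqP ai] /andP[bB /eqP bj] zk zkn.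
    have zl : h z = l by rewrite /h zkn// mxE eqxx.
    rewrite zl eqxx andbT; apply: (hZ a b) => // t.
      rewrite ltnS leq_eqVlt => /orP[/eqP tk|]; last exact: zk.
      have -> : t = kk by exact/val_inj.
      by rewrite -/(h z) -/(h a) -/(h b) zl ai bj.
    move=> kt; rewrite zkn 1?ltnW// mxE ifN//.
    by apply: contraTneq kt => ->; rewrite ltnn.
  - by rewrite -ler_pdivlMr// ge_min lexx.
  - by rewrite -ler_pdivlMr// ge_min lexx orbT.
pose S : seq (int + int) :=
  map inl (enum_fset (h @` A)%fset) ++ map inr (enum_fset (h @` B)%fset).
pose wt (t : int + int) : R := if t is inl _ then al else be.
pose ht (t : int + int) : R := match t with inl i => p i | inr j => q j end.
(* The layer cake: each relative size is the length of an interval from 0. *)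
have key : \sum_(t <- S) wt t * (ht t - 0) <=
    \sum_(l <- (h @` Z)%fset) 1 * (r l - 0).
  apply: le_sum_itv => // [[]|c]//.
  under [leRHS]eq_bigr do rewrite mul1r.
  (* Relative sizes in A and B are at most 1, so only levels in [0, 1) count;
     at those levels the largest layers keep both sides nonempty. *)
  have [c01|c01] := boolP (0 <= c < 1); last first.
    rewrite big1 ?sumr_ge0// => t _.
    rewrite (_ : (_ <= c < _) = false) ?mulr0//; apply: contraNF c01.
    move=> /andP[-> /= /lt_le_trans]; apply; case: t => i /=.
      by rewrite ler_pdivrMr// mul1r.
    by rewrite ler_pdivrMr// mul1r.
  have /andP[c0 c1] := c01.
  rewrite big_cat !big_map /= c0 /= -!mulr_sumr !sum_indicator_card.
  apply: brunn_minkowski_int => //.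
  - apply/fset0Pn; exists iA; have [a aA] := fset0Pn _ iA0.
    by rewrite !inE (h_layer _ _ _ aA) /p uA divff// gt_eqF.
  - apply/fset0Pn; exists jB; have [a aA] := fset0Pn _ jB0.
    by rewrite !inE (h_layer _ _ _ aA) /q vB divff// gt_eqF.
  - move=> i j l; rewrite !inE => /andP[_ cp] /andP[_ cq] lij.
    have cr : c < r l.
      apply: lt_le_trans (step i j l _ _ lij); first by rewrite lt_min cp cq.
        exact: le_lt_trans cp.
      exact: le_lt_trans cq.
    rewrite cr andbT; apply: contraLR cr => lZ; rewrite -leNgt.
    rewrite /r (_ : layer Z l = fset0) ?cardfs0 ?mul0r//.
    by apply/fsetP => b; rewrite in_fset0; apply: contraNF lZ; exact: h_layer.
have card_layers D (c : R) :
    \sum_(i <- (h @` D)%fset) ((#|` layer D i|)%:R / c - 0) = (#|` D|)%:R / c.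
  under eq_bigr do rewrite subr0.
  by rewrite -mulr_suml -natr_sum sum_card_fiber.
move: key; rewrite big_cat !big_map /= -!mulr_sumr !card_layers mul1r.
rewrite ler_pdivlMr// => key; apply: le_trans key.
apply: le_trans (ler_wpM2l w0 (perspective_pow k al0 be0 x0 y0 u0 v0 s0)) _.
rewrite mulrCA [leRHS]mulrC ler_wpM2l ?(ltW R0_gt0)// mulrDr.
by apply: lerD; rewrite mulrCA ler_wpM2l// mulrA ler_wpM2r// invr_ge0 ltW.
Qed.

(** * A discrete Berwald inequality *)

Definition superlevel_count (R : realType) (I : Type) (r : seq I) (f : I -> R)
  (s : R) : R := \sum_(i <- r) (s <= f i)%R%:R.

Lemma superlevel_count_ge0 (R : realType) (I : Type) (r : seq I) (f : I -> R)
  (s : R) : 0 <= superlevel_count r f s.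
Proof. by apply: sumr_ge0. Qed.

Lemma superlevel_count_gt0 (R : realType) (I : eqType) (r : seq I) (f : I -> R)
  (s : R) : 0 < superlevel_count r f s ->
  1 <= superlevel_count r f s /\ exists2 i, i \in r & s <= f i.
Proof.
move=> pos; have [/hasP[i ir sf]|/hasPn nP] := boolP (has (fun i => s <= f i) r).
  split; last by exists i.
  by rewrite /superlevel_count (big_rem i)//= sf lerDl sumr_ge0.
move: pos; rewrite /superlevel_count big1_seq ?ltxx// => i /andP[_ ir].
by rewrite (negbTE (nP i ir)).
Qed.

Lemma has_integral_superlevel (R : realType) (I : eqType) (r : seq I)
    (f : I -> R) (k : nat) : {in r, forall i, 0 <= f i} ->
  has_integral (fun s => s ^+ k * superlevel_count r f s * (0 <= s)%R%:R)
    (\sum_(i <- r) f i ^+ k.+1 / k.+1%:R).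
Proof.
move=> f0; apply: (@has_integral_eq _
    (fun s => \sum_(i <- r) s ^+ k * (0 <= s <= f i)%R%:R)).
  move=> s; rewrite -mulr_sumr -mulrA; congr (_ * _).
  rewrite mulr_suml; apply: eq_bigr => i _.
  by case: (0 <= s); rewrite ?mulr1 ?mulr0.
by apply: has_integral_sum => i ir; apply: has_integral_monomial; exact: f0.
Qed.

(** Here r and q stand for the lattice points of P and of P + C, f for the
    section length, c for the weight, and the interpolation hypothesis for the
    Brunn-Minkowski inequality between level 0 and level t.  The scale is
    normalized so that the comparison profile a_star vanishes at 1. *)
Section DiscreteBerwald.
Variables (R : realType) (I J : eqType) (r : seq I) (q : seq J).
Variables (f : I -> R) (c : J -> R) (m : nat).

Let a := superlevel_count r f.
Let b := superlevel_count q c.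
Let N : R := (size r)%:R.

Hypothesis f0 : {in r, forall i, 0 <= f i}.
Hypothesis c0 : {in q, forall j, 0 <= c j}.
Hypothesis ab : forall s, 0 <= s -> a s <= b s.
Hypothesis N1 : m = 0%N -> N <= 1.
Hypothesis brunn_minkowski : forall t th y, 0 <= t -> 0 <= th <= 1 -> 0 <= y ->
  0 < a t -> N * y ^+ m <= a t -> N * (1 - th + th * y) ^+ m <= b (th * t).

Let a_star (s : R) : R := N * (1 - s) ^+ m * (0 <= s <= 1)%R%:R.

Let a_star_ge0 s : 0 <= a_star s.
Proof.
rewrite /a_star; case: andP => [[_ s1]|_]; last by rewrite mulr0.
by rewrite mulr1 mulr_ge0 ?ler0n// exprn_ge0// subr_ge0.
Qed.

(** If a exceeds the profile at t, then interpolating between N at level 0 and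
    a(t) at level t keeps b above the profile at all earlier levels, because the
    m-th root of the profile is affine up to 1. *)
Lemma crossing s t : 0 <= s < t -> a_star t < a t -> a_star s <= b s.
Proof.
move=> /andP[s0 st] at_lt; have t0 : 0 < t by exact: le_lt_trans st.
have at0 : 0 < a t by exact: le_lt_trans (a_star_ge0 t) at_lt.
have b0 : 0 <= b s by exact: superlevel_count_ge0.
have [s1|s1] := leP s 1; last first.
  by rewrite /a_star [s <= 1]leNgt s1 andbF mulr0.
rewrite /a_star s0 s1 mulr1.
have st01 : 0 <= s / t <= 1.
  by rewrite (divr_ge0 s0 (ltW t0)) ler_pdivrMr// mul1r ltW.
have stt : s / t * t = s by rewrite divfK// gt_eqF.
have [t1|t1] := leP t 1.
  have := @brunn_minkowski t (s / t) (1 - t) (ltW t0) st01.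
  rewrite subr_ge0 stt => /(_ t1 at0).
  rewrite mulrBr mulr1 stt subrKA; apply.
  by move: at_lt; rewrite /a_star (ltW t0) t1 mulr1 => /ltW.
(* Beyond 1 the profile vanishes: interpolate towards 0, using that the affine
   function with value 0 at t is larger than the one with value 0 at 1. *)
have := @brunn_minkowski t (s / t) 0 (ltW t0) st01 (lexx _) at0.
rewrite mulr0 addr0 stt => bm.
apply: (@le_trans _ _ (N * (1 - s / t) ^+ m)).
  rewrite ler_wpM2l ?ler0n// lerXn2r ?nnegrE ?subr_ge0//.
    by case/andP: st01.
  by apply: lerB => //; rewrite ler_pdivrMr// ler_peMr// ltW.
apply: bm; have [a1 _] := superlevel_count_gt0 at0.
rewrite expr0n; case: eqP => [m0|_] /=; last by rewrite mulr0 ltW.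
by rewrite mulr1; apply: le_trans (N1 m0) a1.
Qed.

(** Let T be the last level at which a exceeds the profile.  Pointwise, the
    product of s^n and a - a_star is at most the product of T^n and b - a_star:
    before T because a <= b and a_star <= b, after T because a <= a_star and
    a <= b.  The normalization says that b - a_star has integral 0. *)
Lemma discrete_berwald_normalized :
  m.+1%:R * (\sum_(j <- q) c j) = N ->
  \sum_(i <- r) f i ^+ m.+2 / m.+2%:R <=
    N * ((m.+1`! * m`!)%:R / (m.+1 + m).+1`!%:R).
Proof.
move=> cN.
pose E : set R := [set t | 0 <= t /\ a_star t < a t].
have [T T0 [Tlo Thi]] : exists2 T, 0 <= T &
    (forall s, 0 <= s < T -> a_star s <= b s) /\
    (forall s, T < s -> a s <= a_star s).
  have notE s : 0 <= s -> ~ E s -> a s <= a_star s.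
    by move=> s0 nE; rewrite leNgt; apply/negP => lt; apply: nE.
  have [E0|/set0P[e Ee]] := eqVneq E set0.
    exists 0 => //; split=> [s /andP[s0 /(le_lt_trans s0)]|s s0].
      by rewrite ltxx.
    by apply: notE; [exact: ltW|rewrite E0].
  have supE : has_sup E.
    split; first by exists e.
    exists (\sum_(i <- r) f i) => t [_ /(le_lt_trans (a_star_ge0 t)) at0].
    have [_ [i ir tf]] := superlevel_count_gt0 at0.
    rewrite (big_rem i)//=; apply: le_trans tf _; rewrite lerDl.
    by rewrite big_seq sumr_ge0// => j /mem_rem; exact: f0.
  have E_le t : E t -> t <= sup E by move=> Et; exact: (sup_upper_bound supE).
  exists (sup E); first exact: le_trans (Ee.1) (E_le _ Ee).
  split=> [s /andP[s0 /(sup_gt (proj1 supE))[t [t0 tlt] st]]|s Ts].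
    by apply: (crossing _ tlt); rewrite s0.
  apply: notE; last by move=> /E_le; rewrite leNgt Ts.
  by rewrite (le_trans (le_trans Ee.1 (E_le _ Ee)))// ltW.
(* The inequality is integrated after moving terms so that no subtraction
   remains; the integrals carrying the factor T^n then cancel. *)
have lhs := has_integralD (has_integral_superlevel m.+1 f0)
  (has_integralZ (T ^+ m.+1 * N) (has_integral_beta R 0 m)).
have rhs := has_integralD (has_integralZ N (has_integral_beta R m.+1 m))
  (has_integralZ (T ^+ m.+1) (has_integral_superlevel 0 c0)).
have := has_integral_le lhs rhs; set L := \sum_(i <- r) _.
have -> : T ^+ m.+1 * N * ((0`! * m`!)%:R / (0 + m).+1`!%:R) =
    T ^+ m.+1 * (\sum_(i <- q) c i ^+ 1 / 1%:R).
  rewrite -mulrA; congr (_ * _); rewrite -cN fact0 mul1n add0n factS natrM.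
  under [in RHS]eq_bigr do rewrite expr1 divr1.
  have mf : m`!%:R != 0 :> R by rewrite pnatr_eq0 -lt0n fact_gt0.
  by field; rewrite mf -(natrD _ 1) pnatr_eq0.
rewrite lerD2r; apply => s; cbv beta.
have [s0|s0] := ltP s 0.
  by rewrite /= !mulr0 addr0.
have ab_s := ab s0.
suff : s ^+ m.+1 * a s + T ^+ m.+1 * a_star s <=
    s ^+ m.+1 * a_star s + T ^+ m.+1 * b s.
  by congr (_ <= _); rewrite /a_star /a /b s0 /= expr0; ring.
have a_ge0 : 0 <= a s by exact: superlevel_count_ge0.
have [sT|Ts|sT] := ltgtP s T; last first.
  rewrite -sT [leLHS]addrC lerD2l.
  exact: ler_wpM2l (exprn_ge0 _ s0) _ _ ab_s.
  have pw : T ^+ m.+1 <= s ^+ m.+1 by apply: lerXn2r; rewrite ?nnegrE// ltW.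
  have a_le := Thi _ Ts.
  have := ler_wpM2l (exprn_ge0 m.+1 T0) ab_s.
  rewrite -subr_ge0 in pw; have := ler_wpM2l pw a_le.
  by lra.
have pw : s ^+ m.+1 <= T ^+ m.+1 by apply: lerXn2r; rewrite ?nnegrE// ltW.
have := Tlo s; rewrite s0 sT => /(_ isT) ab_star.
have := ler_wpM2l (exprn_ge0 m.+1 s0) ab_s.
rewrite -subr_ge0 in pw; have := ler_wpM2l pw ab_star.
by lra.
Qed.

End DiscreteBerwald.

Lemma superlevel_count_scale (R : realType) (I : Type) (r : seq I) (f : I -> R)
    (M s : R) : 0 < M ->
  superlevel_count r (fun i => f i / M) s = superlevel_count r f (s * M).
Proof.
by move=> M0; apply: eq_bigr => i _; rewrite ler_pdivlMr.
Qed.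

Lemma discrete_berwald (R : realType) (I J : eqType) (r : seq I) (q : seq J)
    (f : I -> R) (c : J -> R) (m : nat) (M : R) (a := superlevel_count r f)
    (b := superlevel_count q c) (N : R := (size r)%:R) :
  {in r, forall i, 0 <= f i} -> {in q, forall j, 0 <= c j} ->
  (forall s, 0 <= s -> a s <= b s) -> (m = 0%N -> N <= 1) ->
  (forall t th y, 0 <= t -> 0 <= th <= 1 -> 0 <= y ->
     0 < a t -> N * y ^+ m <= a t -> N * (1 - th + th * y) ^+ m <= b (th * t)) ->
  0 < M -> m.+1%:R * (\sum_(j <- q) c j) = N * M ->
  \sum_(i <- r) f i ^+ m.+2 / m.+2%:R <=
    N * M ^+ m.+2 * ((m.+1`! * m`!)%:R / (m.+1 + m).+1`!%:R).
Proof.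
move=> f0 c0 ab N1 bm M0 cN.
have Mn0 : M != 0 by rewrite gt_eqF.
have := @discrete_berwald_normalized R I J r q (fun i => f i / M)
  (fun j => c j / M) m _ _ _ N1 _ _.
rewrite mulrAC => H.
rewrite -ler_pdivrMr ?exprn_gt0//; apply: le_trans (H _ _ _ _ _).
- rewrite mulr_suml le_eqVlt; apply/orP; left; apply/eqP.
  by apply: eq_bigr => i _; rewrite expr_div_n mulrAC.
- by move=> i ir; rewrite divr_ge0 ?f0// ltW.
- by move=> j jq; rewrite divr_ge0 ?c0// ltW.
- by move=> s s0; rewrite !superlevel_count_scale// ab// mulr_ge0// ltW.
- move=> t th y t0 th01 y0; rewrite !superlevel_count_scale// => at0 Na.
  by rewrite -mulrA; apply: bm => //; rewrite mulr_ge0// ltW.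
- by rewrite -mulr_suml mulrA cN mulfK.
Qed.

(** * Lattice points of bounded sets *)

Section Lattice.
Variables (R : realType) (n : nat).

(** Lattice points are handled as integer rows, for which layers and fibers are
    finite sets with decidable membership. *)
Definition of_int_row (z : 'rV[int]_n) : 'rV[R]_n := map_mx intr z.

Definition lattice_points (A : set 'rV[R]_n) : {fset 'rV[int]_n} :=
  fset_set [set z | A (of_int_row z)].

Definition coord_bounded (A : set 'rV[R]_n) : Prop :=
  exists b : R, forall x, A x -> forall i, `|x 0 i| <= b.

Lemma of_int_rowE z i : of_int_row z 0 i = (z 0 i)%:~R.
Proof. by rewrite mxE. Qed.

Lemma of_int_row_inj : injective of_int_row.
Proof.
move=> z z' /rowP zz; apply/rowP => i; have := zz i; rewrite !mxE.
exact: intr_inj.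
Qed.

Lemma finite_lattice (A : set 'rV[R]_n) : coord_bounded A ->
  finite_set [set z | A (of_int_row z)].
Proof.
move=> [b Ab]; pose p : nat := `|Num.floor b|%N.
pose g (M : 'rV['I_(p + p).+1]_n) : 'rV[int]_n :=
  \row_i ((M 0 i)%:Z - p%:Z).
apply: (@sub_finite_set _ _ (g @` [set: 'rV['I_(p + p).+1]_n])); last first.
  by apply: finite_image; exact: finite_finset.
move=> z /= Az; exists (\row_i inord (absz (z 0 i + p%:Z))) => //.
apply/rowP => i; rewrite !mxE.
have := Ab _ Az i; rewrite of_int_rowE -intr_norm => zb.
have zp : `|z 0 i| <= p%:Z.
  have : `|z 0 i| <= Num.floor b by rewrite real_floor_ge_int ?num_real.
  by rewrite /p; lia.
by rewrite inordK; lia.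
Qed.

Lemma in_lattice_points (A : set 'rV[R]_n) z : coord_bounded A ->
  (z \in lattice_points A) <-> A (of_int_row z).
Proof.
move=> /finite_lattice fA; rewrite in_fset_set//.
by split=> [/set_mem|/mem_set].
Qed.

Lemma lattice_count_points (A : set 'rV[R]_n) : coord_bounded A ->
  lattice_count A = #|` lattice_points A|.
Proof.
move=> /finite_lattice fA.
rewrite /lattice_count (_ : A `&` _ = of_int_row @` [set z | A (of_int_row z)]).
  by rewrite fset_set_image// card_imfset//; exact: of_int_row_inj.
apply/seteqP; split=> [x [Ax xZ]|_ [z Az <-]].
  exists (map_mx Num.floor x) => /=.
    rewrite (_ : of_int_row _ = x)//.
    by apply/rowP => i; rewrite !mxE floorK.
  by apply/rowP => i; rewrite !mxE floorK.
by split=> // i; rewrite of_int_rowE.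
Qed.

End Lattice.

Lemma coord_boundedS (R : realType) (n : nat) (A B : set 'rV[R]_n) :
  A `<=` B -> coord_bounded B -> coord_bounded A.
Proof. by move=> AB [b hb]; exists b => x /AB /hb. Qed.

Lemma minkowski_sum_bounded (R : realType) (n : nat) (A B : set 'rV[R]_n) :
  coord_bounded A -> coord_bounded B -> coord_bounded (minkowski_sum A B).
Proof.
move=> [a ha] [b hb]; exists (a + b) => _ [x Ax [y By <-]] i.
by rewrite mxE (le_trans (ler_normD _ _))// lerD ?ha ?hb.
Qed.

(** * Sections of a convex body in the last direction *)

Section LastDirection.
Variables (R : realType) (m : nat).
Local Notation e := (last_vec R m).
Implicit Types (x y : 'rV[R]_m.+1) (K : set 'rV[R]_m.+1) (t : R).

Lemma last_vecE i : e 0 i = (i == ord_max)%:R.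
Proof. by rewrite mxE eqxx. Qed.

Lemma dotp_last x : dotp x e = x 0 ord_max.
Proof.
rewrite /dotp (bigD1 ord_max)//= last_vecE eqxx mulr1 big1 ?addr0// => i ni.
by rewrite last_vecE (negbTE ni) mulr0.
Qed.

Lemma orth_projE x i :
  orth_proj e x 0 i = if i == ord_max then 0 else x 0 i.
Proof.
rewrite /orth_proj dotp_last !mxE eqxx /=.
by case: eqP => [->|_]; rewrite ?mulr1 ?subrr// mulr0 subr0.
Qed.

Lemma orth_proj_split x : x = orth_proj e x + x 0 ord_max *: e.
Proof. by rewrite /orth_proj dotp_last subrK. Qed.

Lemma coord_line y t i : (y + t *: e) 0 i =
  y 0 i + (if i == ord_max then t else 0).
Proof. by rewrite !mxE eqxx; case: eqP => _; rewrite ?mulr1 ?mulr0. Qed.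

Lemma orth_proj_line y t : y 0 ord_max = 0 -> orth_proj e (y + t *: e) = y.
Proof.
move=> y0; apply/rowP => i; rewrite orth_projE coord_line.
by case: eqP => [->|_]; rewrite ?y0 ?addr0.
Qed.

Lemma orth_proj_image0 K y : (orth_proj e @` K) y -> y 0 ord_max = 0.
Proof. by move=> [x _ <-]; rewrite orth_projE eqxx. Qed.

Lemma continuous_orth_proj : continuous (orth_proj e).
Proof.
move=> x; rewrite (_ : orth_proj e = fun x => x - x 0 ord_max *: e); last first.
  by apply/funext => z; rewrite /orth_proj dotp_last.
exact: (cvgB cvg_id (cvgZr_tmp (a := e) (@coord_continuous _ _ _ 0 ord_max x))).
Qed.

Lemma convex_combination K x y t : convex_set K -> K x -> K y -> 0 <= t <= 1 ->
  K (t *: x + (1 - t) *: y).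
Proof.
move=> cK Kx Ky t01.
pose p : {i01 R} := @Itv01 R t (andP t01).1 (andP t01).2.
exact: (set_mem (cK x y p (mem_set Kx) (mem_set Ky))).
Qed.

Lemma compact_coord_bounded K : compact K -> coord_bounded K.
Proof.
move=> /compact_bounded[M [_ KM]]; exists (M + 1) => x Kx i.
apply: le_trans (KM (M + 1) _ x Kx); last by rewrite ltrDl.
rewrite [leRHS]mx_normE -[leLHS]nngE num_le.
exact: (@le_bigmax _ _ _ _ (fun ij => `|x ij.1 ij.2|%:nng) (0, i)).
Qed.

(** The section over y is the segment from y + lo(y) e to y + hi(y) e.  Outside
    the projection the values of lo and hi are arbitrary. *)
Definition section_ends K (lo hi : 'rV[R]_m.+1 -> R) : Prop :=
  forall y, (orth_proj e @` K) y -> lo y <= hi y /\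
    (forall t, K (y + t *: e) <-> lo y <= t <= hi y).

(** The last coordinate attains its extreme values on the compact slice of K
    over y, and convexity fills the segment between them. *)
Lemma section_ends_exist K : compact K -> convex_set K ->
  exists lo hi, section_ends K lo hi.
Proof.
move=> cK cvK.
have /choice[g gP] : forall y, exists p : R * R, (orth_proj e @` K) y ->
    p.1 <= p.2 /\ (forall t, K (y + t *: e) <-> p.1 <= t <= p.2).
  move=> y; have [Py|nPy] := pselect ((orth_proj e @` K) y); last first.
    by exists (0, 0) => /nPy.
  have y0 := orth_proj_image0 Py.
  pose D := K `&` (orth_proj e @^-1` [set y]).
  have cD : compact D.
    apply: compact_closedI => //; apply: preimage_closed.
      by move=> ? _; exact: continuous_orth_proj.
    exact/accessible_closed_set1/hausdorff_accessible/norm_hausdorff.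
  have D0 : D !=set0 by case: Py => x Kx xy; exists x; split.
  have cc : {within D, continuous (fun x : 'rV[R]_m.+1 => x 0 ord_max)}.
    by apply: continuous_subspaceT => x; exact: coord_continuous.
  have [b /set_mem[Kb yb] bmax] := compact_EVT_max D0 cD cc.
  have [a /set_mem[Ka ya] amin] := compact_EVT_min D0 cD cc.
  have inD t : K (y + t *: e) -> y + t *: e \in D.
    by move=> Kt; apply/mem_set; split=> //=; exact: orth_proj_line.
  exists (a 0 ord_max, b 0 ord_max) => _ /=; split.
    by apply: bmax; apply/mem_set.
  move=> t; split=> [Kt|/andP[at_ tb]].
    have := bmax _ (inD _ Kt); have := amin _ (inD _ Kt).
    by rewrite coord_line eqxx y0 add0r => -> ->.
  have Ea := orth_proj_split a; have Eb := orth_proj_split b.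
  rewrite ya in Ea; rewrite yb in Eb.
  set al := a 0 ord_max in Ea at_; set be := b 0 ord_max in Eb tb.
  have [ab|ab] := eqVneq al be.
    by rewrite (_ : t = al) -?Ea//; apply/le_anti; rewrite at_ ab tb.
  have ab0 : 0 < be - al by rewrite subr_gt0 lt_neqAle ab (le_trans at_ tb).
  have lam01 : 0 <= (be - t) / (be - al) <= 1.
    rewrite ler_pdivrMr// mul1r lerD2l lerN2 at_ andbT.
    by rewrite divr_ge0 ?(ltW ab0)// subr_ge0.
  have := convex_combination cvK Ka Kb lam01; rewrite Ea Eb; congr K.
  apply/rowP => i; rewrite !mxE; move: (ab0); rewrite lt0r => /andP[nz _].
  by field.
exists (fun y => (g y).1), (fun y => (g y).2) => y; exact: gP.
Qed.

Lemma section_vol1_ends K lo hi y : section_ends K lo hi ->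
  (orth_proj e @` K) y -> section_vol1 e K y = (hi y - lo y)%:E.
Proof.
move=> ends /ends[lohi Kt]; rewrite /section_vol1.
rewrite (_ : [set t | _] = `[lo y, hi y]%classic).
  rewrite lebesgue_measure_itv/= lte_fin.
  case: ltP => // hilo.
  by rewrite (@le_anti _ _ (lo y) (hi y)) ?subrr// lohi hilo.
by apply/seteqP; split=> t /=; rewrite in_itv/= => /Kt.
Qed.

End LastDirection.

(** * Lattice points of a convex body and of its symmetrization *)

Section ConvexBody.
Variables (R : realType) (m : nat) (K : set 'rV[R]_m.+1).
Variables (lo hi : 'rV[R]_m.+1 -> R).
Hypotheses (cK : compact K) (cvK : convex_set K) (ends : section_ends K lo hi).

Local Notation e := (last_vec R m).
Local Notation P := (orth_proj e @` K).
Local Notation C := (@flat_cube R m).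
Local Notation emb := (@of_int_row R m.+1).

Let len y := hi y - lo y.

Let bK : coord_bounded K.
Proof. exact: compact_coord_bounded. Qed.

Lemma len_ge0 y : P y -> 0 <= len y.
Proof. by move=> /ends[? _]; rewrite subr_ge0. Qed.

Lemma section_mem y t : P y -> K (y + t *: e) <-> lo y <= t <= hi y.
Proof. by move=> /ends[_]; exact. Qed.

Definition height (z : 'rV[int]_m.+1) : R :=
  (z 0 ord_max)%:~R - lo (orth_proj e (emb z)).

Lemma emb_split z : emb z = orth_proj e (emb z) + (z 0 ord_max)%:~R *: e.
Proof. by rewrite [LHS]orth_proj_split of_int_rowE. Qed.

Lemma height_bounds z : K (emb z) ->
  0 <= height z <= len (orth_proj e (emb z)).
Proof.
move=> Kz; have Py : P (orth_proj e (emb z)) by exists (emb z).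
have := Kz; rewrite {1}emb_split => /(section_mem _ Py)/andP[h1 h2].
by rewrite /height /len subr_ge0 h1 lerD2r.
Qed.

(** Going down by r from a point of the section stays in the section exactly
    when r does not exceed the height of the point above the lower end. *)
Lemma mem_self_intersection (r : R) z : 0 <= r ->
  (K `&` translate (r *: e) K) (emb z) <-> K (emb z) /\ r <= height z.
Proof.
move=> r0.
have trE : translate (r *: e) K (emb z) <-> K (emb z - r *: e).
  split=> [[x Kx <-]|Kx]; first by rewrite addrC addKr.
  by exists (emb z - r *: e) => //; rewrite addrC subrK.
have [Kz|nKz] := pselect (K (emb z)); last by split=> -[].
have Py : P (orth_proj e (emb z)) by exists (emb z).
have Ez : emb z - r *: e =
    orth_proj e (emb z) + ((z 0 ord_max)%:~R - r) *: e.
  by rewrite scalerBl addrA -emb_split.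
have /andP[h1 h2] := height_bounds Kz.
rewrite /height /len in h1 h2 *.
split=> -[_ h]; split=> //.
  by move/trE: h; rewrite Ez => /(section_mem _ Py); lra.
by apply/trE; rewrite Ez; apply/(section_mem _ Py); lra.
Qed.

Lemma integral_lattice_covariogram :
  (\int[lebesgue_measure]_(r in `[0%R, +oo[)
     (r ^+ m * (lattice_count (K `&` translate (r *: e) K))%:R)%:E =
   (\sum_(z <- lattice_points K) height z ^+ m.+1 / m.+1%:R)%R%:E)%E.
Proof.
have h0 : {in lattice_points K, forall z, 0 <= height z}.
  by move=> z /(in_lattice_points _ bK)/height_bounds/andP[].
have [gi gv] := has_integral_superlevel m h0.
rewrite -gv /Rintegral fineK; last exact: integrable_fin_num.
rewrite [LHS]integral_mkcond; apply: eq_integral => r _.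
rewrite patchE mem_setE in_itv/= andbT.
case: ifPn => [r0|_]; last by rewrite mulr0.
rewrite mulr1; congr (_ * _)%:E.
rewrite lattice_count_points; last by apply: coord_boundedS bK => x [].
rewrite /superlevel_count sum_indicator_card; congr (_%:R).
have bKt : coord_bounded (K `&` translate (r *: e) K).
  by apply: coord_boundedS bK => x [].
congr (size (enum_fset _)); apply/fsetP => z; rewrite !inE/=.
apply/idP/andP => [/(in_lattice_points _ bKt)/(mem_self_intersection _ r0)[Kz rz]|].
  by split=> //; apply/in_lattice_points.
move=> [/(in_lattice_points _ bK) Kz rz].
by apply/in_lattice_points => //; apply/mem_self_intersection.
Qed.

Lemma len_le_radial y : P y -> len y <= radial (difference_body K) e.
Proof.
move=> Py; have /= l0 := len_ge0 Py.
have [b hb] := bK.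
apply: sup_upper_bound; last first.
  split=> //; exists (y + hi y *: e).
    by apply/section_mem => //; rewrite lexx andbT -subr_ge0.
  exists (y + lo y *: e).
    by apply/section_mem => //; rewrite lexx -subr_ge0.
  by rewrite opprD addrACA subrr add0r -scalerBl.
split.
  exists 0; split=> //; case: Py => x Kx _; exists x => //; exists x => //.
  by rewrite subrr scale0r.
exists (b + b) => r [r0 [x Kx [x' Kx' xx']]].
have := congr1 (fun v : 'rV[R]_m.+1 => v 0 ord_max) xx'.
rewrite !mxE !eqxx mulr1 => <-.
have := hb _ Kx ord_max; have := hb _ Kx' ord_max.
by rewrite !ler_norml; lra.
Qed.

Lemma projection_bounded : coord_bounded P.
Proof.
have [b hb] := bK; exists b => _ [x Kx <-] i; rewrite orth_projE.
case: eqP => _; last exact: hb.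
by rewrite normr0; apply: le_trans (hb _ Kx ord_max).
Qed.

Let bP : coord_bounded P := projection_bounded.

Definition drop_last (z : 'rV[int]_m.+1) : 'rV[int]_m.+1 :=
  \row_i (if i == ord_max then 0 else z 0 i).

Lemma drop_lastE z i : drop_last z 0 i = if i == ord_max then 0 else z 0 i.
Proof. by rewrite mxE. Qed.

Lemma emb_drop_last z : emb (drop_last z) = orth_proj e (emb z).
Proof.
apply/rowP => i; rewrite orth_projE !of_int_rowE drop_lastE.
by case: eqP.
Qed.

Lemma drop_last_inj z z' : drop_last z = drop_last z' ->
  z 0 ord_max = z' 0 ord_max -> z = z'.
Proof.
move=> /rowP dzz' zz'; apply/rowP => i; have := dzz' i; rewrite !drop_lastE.
by case: eqP => [->|].
Qed.

(** The lattice points of K in one section are told apart by their integer last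
    coordinate, which reduces the claim to sum_pow_spread. *)
Lemma sum_height_le :
  \sum_(z <- lattice_points K) height z ^+ m.+1 <=
  \sum_(y <- lattice_points P)
    (len (emb y) ^+ m.+1 + len (emb y) ^+ m.+2 / m.+2%:R).
Proof.
rewrite (@sum_fiber _ _ _ drop_last _ (lattice_points P)); last first.
  move=> z /(in_lattice_points _ bK) Kz; apply/in_lattice_points => //.
  by rewrite emb_drop_last; exists (emb z).
rewrite big_seq [leRHS]big_seq; apply: ler_sum => y.
move=> /(in_lattice_points _ bP) Py.
pose A := [fset z in lattice_points K | drop_last z == y]%fset.
have AP z : z \in A -> K (emb z) /\ orth_proj e (emb z) = emb y.
  rewrite !inE/= => /andP[/(in_lattice_points _ bK) Kz /eqP <-].
  by rewrite emb_drop_last.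
pose h (z : 'rV[int]_m.+1) := z 0 ord_max.
rewrite big_fset_condE -/A.
have hinj : {in A &, injective h}.
  move=> z z'; rewrite !inE/= => /andP[_ /eqP zy] /andP[_ /eqP z'y].
  by apply: drop_last_inj; rewrite zy z'y.
apply: le_trans (@sum_pow_spread R m [fset h z | z in A]%fset (lo (emb y))
  (len (emb y)) _ _).
- rewrite [leRHS]big_imfset//= [leLHS]big_seq [leRHS]big_seq le_eqVlt.
  apply/orP; left.
  by apply/eqP; apply: eq_bigr => z /AP[_ zy]; rewrite /height zy.
- exact: len_ge0.
- move=> _ /imfsetP[/= z zA ->]; have [Kz zy] := AP _ zA.
  rewrite /len [_ + (_ - _)]addrC subrK; apply/(section_mem _ Py).
  by rewrite -zy -emb_split.
Qed.

Local Notation S := (steiner e K).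
Local Notation PC := (minkowski_sum P C).
Local Notation SC := (minkowski_sum S C).

Lemma flat_cube_bounded : coord_bounded C.
Proof.
exists 1 => x [x0 xC] i; have [->|/xC] := eqVneq i ord_max.
  by rewrite x0 normr0.
by rewrite ler_norml => /andP[/ltW -> /ltW ->].
Qed.

Lemma steinerE x : S x <-> P (orth_proj e x) /\
  `|x 0 ord_max| <= len (orth_proj e x) / 2.
Proof.
split=> [[y [t [Py tl ->]]]|[Py tl]]; last first.
  exists (orth_proj e x), (x 0 ord_max); split=> //; last exact: orth_proj_split.
  by rewrite (section_vol1_ends ends Py) -EFinM lee_fin mulrC.
have y0 := orth_proj_image0 Py.
rewrite orth_proj_line// coord_line eqxx y0 add0r; split=> //.
by move: tl; rewrite (section_vol1_ends ends Py) -EFinM lee_fin mulrC.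
Qed.

Lemma steiner_bounded : coord_bounded S.
Proof.
have [b hb] := bK; have [b' hb'] := bP.
exists (Order.max b b') => x /steinerE[Py xl] i; rewrite le_max.
have [->|ni] := eqVneq i ord_max; last first.
  by have := hb' _ Py i; rewrite orth_projE (negbTE ni) => ->; rewrite orbT.
have ll := len_ge0 Py; have y0 := orth_proj_image0 Py.
set y := orth_proj e x in Py xl ll y0.
have Khi : K (y + hi y *: e).
  by apply/section_mem => //; rewrite lexx andbT -subr_ge0.
have Klo : K (y + lo y *: e).
  by apply/section_mem => //; rewrite lexx -subr_ge0.
have := hb _ Klo ord_max; rewrite coord_line eqxx y0 add0r => /ler_normlP[h1 _].
have := hb _ Khi ord_max; rewrite coord_line eqxx y0 add0r => /ler_normlP[_ h2].
apply/orP; left; rewrite (le_trans xl)// /len; lra.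
Qed.

Let bC : coord_bounded C := flat_cube_bounded.
Let bPC : coord_bounded PC := minkowski_sum_bounded bP bC.
Let bSC : coord_bounded SC := minkowski_sum_bounded steiner_bounded bC.

(** The added 1 is the contribution of the lattice points of P + C; it makes up
    for the integers lost when a segment of length f is counted. *)
Definition fiber_weight (z : 'rV[int]_m.+1) : R :=
  (#|` [fset w in lattice_points SC | drop_last w == z]%fset|)%:R + 1.

Lemma sum_fiber_weight : \sum_(z <- lattice_points PC) fiber_weight z =
  (#|` lattice_points SC| + #|` lattice_points PC|)%:R.
Proof.
rewrite big_split natrD; congr (_ + _); last first.
  by rewrite card_fset_sum1 natr_sum.
rewrite -[RHS](_ : \sum_(w <- lattice_points SC) 1%:R = _); last first.
  by rewrite card_fset_sum1 natr_sum.
rewrite (@sum_fiber _ _ _ drop_last (lattice_points SC) (lattice_points PC)).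
  by apply: eq_bigr => z _; rewrite big_fset_condE card_fset_sum1 natr_sum.
move=> w /(in_lattice_points _ bSC)[x /steinerE[Px _] [v Cv xv]].
apply/in_lattice_points => //; rewrite emb_drop_last.
exists (orth_proj e x) => //; exists v => //; rewrite -xv.
apply/rowP => i; rewrite mxE !orth_projE mxE; case: eqP => // ->.
by case: Cv => ->; rewrite addr0.
Qed.

(** The points z + k e with |k| <= f(y) / 2 belong to S + C.  With p the integer
    part of f(y) / 2 there are 2 p + 1 of them, and 2 p + 2 > f(y). *)
Lemma fiber_weight_cover y z s : P y -> C (emb z - y) -> s <= len y ->
  z \in lattice_points PC /\ s <= fiber_weight z.
Proof.
move=> Py Czy sl; have y0 := orth_proj_image0 Py.
have z0 : z 0 ord_max = 0.
  case: Czy => + _; rewrite !mxE y0 subr0 => /eqP.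
  by rewrite intr_eq0 => /eqP.
split.
  apply/in_lattice_points => //; exists y => //; exists (emb z - y) => //.
  by rewrite addrC subrK.
have l0 := len_ge0 Py.
pose p : nat := `|Num.floor (len y / 2)|%N.
have pE : p%:Z = Num.floor (len y / 2).
  by rewrite /p gez0_abs// floor_ge0 divr_ge0.
pose up (k : nat) : 'rV[int]_m.+1 :=
  \row_i (if i == ord_max then k%:Z - p%:Z else z 0 i).
have up_inj : injective up.
  move=> k k' /rowP/(_ ord_max); rewrite !mxE eqxx; lia.
have : (size (map up (iota 0 (p + p).+1)) <=
    #|` [fset w in lattice_points SC | drop_last w == z]%fset|)%N.
  apply: uniq_leq_size; first by rewrite map_inj_uniq// iota_uniq.
  move=> _ /mapP[k + ->]; rewrite mem_iota add0n ltnS => /andP[_ kp].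
  rewrite !inE/=; apply/andP; split; last first.
    apply/eqP/rowP => i; rewrite !mxE; case: eqP => [->|//].
    by rewrite z0.
  apply/in_lattice_points => //.
  exists (y + (k%:Z - p%:Z)%:~R *: e).
    apply/steinerE; rewrite orth_proj_line// coord_line eqxx y0 add0r.
    split=> //; apply: (@le_trans _ _ (p%:Z)%:~R); last first.
      by rewrite pE floor_le.
    by rewrite -intr_norm ler_int; lia.
  exists (emb z - y) => //; rewrite addrC addrA subrK.
  apply/rowP => i; rewrite coord_line !of_int_rowE mxE.
  by case: eqP => [->|_]; rewrite ?z0 ?add0r ?addr0.
rewrite size_map size_iota -(ler_nat R) => card.
have := floorD1_gt (len y / 2); rewrite -pE intrD -pmulrn => lt.
rewrite /fiber_weight; move: card; rewrite -natr1 natrD => card.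
by move: lt card => /=; set q : R := p%:R; lra.
Qed.

Lemma lattice_projection_le1 : m = 0%N -> (#|` lattice_points P| <= 1)%N.
Proof.
move=> m0; suff /fsubset_leq_card : (lattice_points P `<=` [fset 0])%fset.
  by rewrite cardfs1.
apply/fsubsetP => z /(in_lattice_points _ bP)/orth_proj_image0.
rewrite of_int_rowE inE => /eqP; rewrite intr_eq0 => /eqP z0.
apply/eqP/rowP => i; rewrite mxE -[RHS]z0; congr (z 0 _).
by apply/val_inj => /=; have := ltn_ord i; lia.
Qed.

(** Concavity of the section length, with the nonnegative contribution of x
    dropped: x plays the role of level 0. *)
Lemma len_interpolation x y t : P x -> P y -> 0 <= t <= 1 ->
  P ((1 - t) *: x + t *: y) /\
  t * len y <= len ((1 - t) *: x + t *: y).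
Proof.
move=> Px Py t01.
set w := _ + _.
have s01 : 0 <= 1 - t <= 1 by lra.
have comb u v : lo x <= u <= hi x -> lo y <= v <= hi y ->
    K (w + ((1 - t) * u + t * v) *: e).
  move=> /(section_mem _ Px) Ku /(section_mem _ Py) Kv.
  have := convex_combination cvK Ku Kv s01; rewrite subKr.
  congr K; apply/rowP => i; rewrite !mxE; ring.
have lx := len_ge0 Px; have ly := len_ge0 Py; rewrite /len in lx ly *.
have w0 : w 0 ord_max = 0.
  by rewrite !mxE (orth_proj_image0 Px) (orth_proj_image0 Py) !mulr0 addr0.
have Klo : K (w + ((1 - t) * lo x + t * lo y) *: e) by apply: comb; lra.
have Khi : K (w + ((1 - t) * hi x + t * hi y) *: e) by apply: comb; lra.
have Pw : P w by eexists; [exact: Klo|exact: orth_proj_line].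
split=> //.
have /(section_mem _ Pw)/andP[l1 _] := Klo.
have /(section_mem _ Pw)/andP[_ h1] := Khi.
have : 0 <= (1 - t) * (hi x - lo x) by rewrite mulr_ge0//; lra.
by lra.
Qed.

Lemma flat_cube0 y : C (y - y).
Proof.
by rewrite subrr; split=> [|i _]; rewrite !mxE// ltrN10 ltr01.
Qed.

(** The lattice points of P play the role of level 0 and those with section
    length at least t the role of level t.  A lattice point z with
    z - ((1 - th) a + th b) in C then has weight at least th t, by
    len_interpolation and fiber_weight_cover. *)
Lemma lattice_berwald (N := #|` lattice_points P|)
    (W := (#|` lattice_points SC| + #|` lattice_points PC|)%N) :
  (0 < N)%N ->
  \sum_(y <- lattice_points P) len (emb y) ^+ m.+2 / m.+2%:R <=
  N%:R * (m.+1%:R * W%:R / N%:R) ^+ m.+2 *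
    ((m.+1`! * m`!)%:R / (m.+1 + m).+1`!%:R).
Proof.
move=> N0.
have latP y : y \in lattice_points P -> P (emb y).
  by move/(in_lattice_points _ bP).
have PPC y s : y \in lattice_points P -> s <= len (emb y) ->
    y \in lattice_points PC /\ s <= fiber_weight y.
  by move=> /latP Py; apply: (fiber_weight_cover Py); exact: flat_cube0.
have W0 : (0 < W)%N.
  move: N0; rewrite /N cardfs_gt0 => /fset0Pn[y yP].
  have [yPC _] := PPC _ _ yP (lexx _).
  rewrite addn_gt0; apply/orP; right; rewrite cardfs_gt0.
  by apply/fset0Pn; exists y.
have NR : 0 < N%:R :> R by rewrite ltr0n.
apply: (@discrete_berwald R _ _ (enum_fset (lattice_points P))
  (enum_fset (lattice_points PC)) (fun y => len (emb y)) fiber_weight m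
  (m.+1%:R * W%:R / N%:R)).
- by move=> y /latP; exact: len_ge0.
- by move=> z _; rewrite addr_ge0.
- move=> s s0; rewrite /superlevel_count !sum_indicator_card ler_nat.
  apply: fsubset_leq_card; apply/fsubsetP => y; rewrite !inE/=.
  by move=> /andP[yP /(PPC _ _ yP)[-> ->]].
- by move=> m0; rewrite -[1]/(1%:R) ler_nat; exact: lattice_projection_le1.
- move=> t th y t0 th01 y0 at0 Nat.
  have [_ [y1 y1P ty1]] := superlevel_count_gt0 at0.
  have agree0 (D : {fset 'rV[int]_m.+1}) : (D `<=` lattice_points P)%fset ->
      agree_from m D.
    have last0 a : a \in lattice_points P -> forall i : 'I_m.+1, (m <= i)%N ->
        a 0 i = 0.
      move=> /latP/orth_proj_image0; rewrite of_int_rowE => a0 i mi.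
      move: mi; rewrite leq_ord_max => /eqP ->.
      by apply/eqP; rewrite -(intr_eq0 R) a0.
    move=> /fsubsetP DP a a' /DP aP /DP a'P i mi.
    by rewrite (last0 _ aP)// (last0 _ a'P).
  pose B := [fset y' in lattice_points P | t <= len (emb y')]%fset.
  pose Z := [fset z in lattice_points PC | th * t <= fiber_weight z]%fset.
  have th1 : 0 <= 1 - th by lra.
  have th0 : 0 <= th by lra.
  have := @discrete_brunn_minkowski R m.+1 (1 - th) th th1 th0 (subrK _ _) m
    (lattice_points P) B Z 0 (size (enum_fset (lattice_points P)))%:R 1 y
    (leqnSn m).
  rewrite mulr1 /superlevel_count sum_indicator_card -/Z; apply=> //.
  + by rewrite -cardfs_gt0.
  + by apply/fset0Pn; exists y1; rewrite !inE/= y1P.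
  + exact: agree0.
  + by apply: agree0; apply/fsubsetP => b; rewrite !inE/= => /andP[].
  + move=> a b z aP; rewrite !inE/= => /andP[bP' tb] zi zm.
    have [Pw lw] := len_interpolation (latP _ aP) (latP _ bP') th01.
    have [] // := fiber_weight_cover (z := z) (s := th * t) Pw.
    * split.
        have := orth_proj_image0 (latP _ bP').
        have := orth_proj_image0 (latP _ aP).
        have z0 : z 0 ord_max = 0 by rewrite zm// mxE.
        rewrite !of_int_rowE => a0 b0.
        by rewrite !mxE z0 a0 b0 !mulr0 addr0 subr0.
      move=> i ni; rewrite -ltr_norml.
      have im : (i < m)%N by rewrite ltnNge leq_ord_max.
      by have := zi i im; rewrite !mxE opprD addrA.
    * by apply: le_trans lw; rewrite ler_wpM2l//.
    * by move=> -> ->.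
  + by rewrite expr1n mulr1.
  + by move: Nat; rewrite /superlevel_count sum_indicator_card.
- by rewrite divr_gt0 ?mulr_gt0 ?ltr0n.
- rewrite sum_fiber_weight -/W -/N.
  by rewrite [RHS]mulrC divfK// gt_eqF.
Qed.

End ConvexBody.

(** * The covariogram inequality *)

(** With n = m + 1, the beta integral n! m! / (2 n)! is the inverse of n times
    the central binomial coefficient. *)
Lemma berwald_constant (R : realType) (m : nat) (N W : R) (n := m.+1) : N != 0 ->
  'C(2 * n, n)%:R / n%:R ^+ n * (N * (n%:R * W / N) ^+ n.+1 *
    ((n`! * m`!)%:R / (n + m).+1`!%:R)) = W ^+ n.+1 / N ^+ n.
Proof.
move=> N0.
have fact0 k : k`!%:R != 0 :> R by rewrite pnatr_eq0 -lt0n fact_gt0.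
have n0 : n%:R != 0 :> R by rewrite pnatr_eq0.
have binE : 'C(2 * n, n)%:R * (n%:R * (n`! * m`!)%:R) = (2 * n)`!%:R :> R.
  have -> : n%:R * (n`! * m`!)%:R = (n`! * n`!)%:R :> R.
    by rewrite -natrM mulnCA -factS.
  rewrite -natrM -(@bin_fact (2 * n) n) ?leq_pmull//.
  by rewrite [(2 * n - n)%N](_ : _ = n)// mul2n -addnn addnK.
have -> : (n + m).+1 = (2 * n)%N by rewrite mul2n -addnn addnS.
have bin0 : 'C(2 * n, n)%:R != 0 :> R.
  by rewrite pnatr_eq0 -lt0n bin_gt0 leq_pmull.
have mn0 : (n`! * m`!)%:R != 0 :> R by rewrite natrM mulf_neq0.
rewrite -binE expr_div_n exprMn [n%:R ^+ n.+1]exprSr [N ^+ n.+1]exprSr.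
have Nn0 : N ^+ n != 0 by rewrite expf_neq0.
have nn0 : n%:R ^+ n != 0 :> R by rewrite expf_neq0.
move: bin0 mn0 n0; move: ('C(_, _)%:R : R) ((_ * _)%:R : R) (n%:R : R) nn0.
by move=> b q x nn0 b0 q0 x0; field; rewrite N0 Nn0 nn0 x0 b0 q0.
Qed.

Theorem corollary1p5 (R : realType) (m : nat) (K : set 'rV[R]_m.+1) :
  let n := m.+1 in
  let e := last_vec R m in
  let c : R := 'C(2 * n, n)%:R / n%:R ^+ n in
  let P := orth_proj e @` K in
  let C := @flat_cube R m in
  convex_body K ->
  ereal_sup [set section_vol1 e K y | y in orth e] = section_vol1 e K 0 ->
  ((c * n%:R)%:E *
     \int[lebesgue_measure]_(r in `[0%R, +oo[)
       (r ^+ n.-1 * (lattice_count (K `&` translate (r *: e) K))%:R)%:E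
   <= (c * radial (difference_body K) e ^+ n * (lattice_count P)%:R
       + (lattice_count (minkowski_sum (steiner e K) C)
          + lattice_count (minkowski_sum P C))%:R ^+ n.+1
         / (lattice_count P)%:R ^+ n)%:E)%E.
Proof.
move=> n e c P C [cK cvK _] _.
have [lo [hi ends]] := section_ends_exist cK cvK.
have bP : coord_bounded P := projection_bounded cK.
have bC : coord_bounded C := flat_cube_bounded R m.
have bPC := minkowski_sum_bounded bP bC.
have bSC := minkowski_sum_bounded (steiner_bounded cK ends) bC.
rewrite (integral_lattice_covariogram cK ends) -EFinM lee_fin.
rewrite !lattice_count_points// -/e -/P -/C.
set N := #|` lattice_points P|; set W := (_ + _)%N.
have c0 : 0 <= c by rewrite divr_ge0 ?exprn_ge0.
have n0 : n%:R != 0 :> R by rewrite pnatr_eq0.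
rewrite -mulr_suml [leLHS](_ : _ =
    c * \sum_(z <- lattice_points K) height lo z ^+ n); last first.
  by rewrite -mulrA; congr (_ * _); rewrite mulrC divfK.
apply: le_trans (ler_wpM2l c0 (sum_height_le cK ends)) _.
rewrite big_split mulrDr; apply: lerD.
  rewrite -[leRHS]mulrA; apply: ler_wpM2l => //.
  rewrite mulr_natr -sumr_const_seq.
  rewrite big_seq [leRHS]big_seq; apply: ler_sum => y.
  move=> /(in_lattice_points _ bP) Py.
  have l0 := len_ge0 ends Py; have lr := len_le_radial cK ends Py.
  by apply: lerXn2r; rewrite ?nnegrE ?(le_trans l0 lr).
have [N0|N0] := posnP N.
  have -> : lattice_points P = fset0 by exact: cardfs0_eq.
  by rewrite big_seq_fset0 mulr0 divr_ge0 ?exprn_ge0.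
rewrite -(@berwald_constant R m); last by rewrite pnatr_eq0 -lt0n.
by apply: ler_wpM2l => //; exact: lattice_berwald.
Qed.
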